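(* Let $R$ be a partially ordered commutative ring. Then the following are equivalent: (i) There exists a compact Hausdorff space $X$ such that $R$ is isomorphic (as a partially ordered commutative ring) to a subring of $\mathscr{C}_{\mathrm{a.e.}}(X)$. (ii) $R$ is localizable and the extended Gelfand transformation $\widehat{\cdot}\colon R \to \mathscr{C}_\approx(\mathcal{D}_{\mathrm{loc}}(R))$ is an order embedding. (iii) $R$ is archimedean and localizable. (iv) $R$ is archimedean and strongly localizable. Moreover, if these equivalent statements hold, then every $\mathrm{O}_{s<\infty}$ with $s\in\mathrm{Loc}(R)$ is dense in $\mathcal{K}(R)$, so that the map sending the $\approx$-class in $\mathscr{C}_\approx(\mathcal{D}_{\mathrm{loc}}(R))$ of a function $f$ to its class in $\mathscr{C}_{\mathrm{a.e.}}(\mathcal{K}(R))$ is a well-defined positive ring morphism and order embedding $\mathscr{C}_\approx(\mathcal{D}_{\mathrm{loc}}(R)) \to \mathscr{C}_{\mathrm{a.e.}}(\mathcal{K}(R))$.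
   Context: All rings are commutative with unit $1$; subrings contain $1$; ring morphisms are unital. A partially ordered commutative ring is a commutative ring $R$ with a partial order $\le$ such that $r\le s$ implies $r+t\le s+t$, and whose positive cone $R^+=\{r: 0\le r\}$ is closed under multiplication and contains all squares; subrings carry the induced order. A ring morphism $\Phi\colon R\to S$ of such rings is positive if $\Phi(R^+)\subseteq S^+$, an order embedding if it is positive and $\Phi^{-1}(S^+)\subseteq R^+$; an isomorphism is a bijective ring morphism with $\Phi,\Phi^{-1}$ positive. $\mathbb{N}=\{1,2,\dots\}$, $\mathbb{N}_0=\mathbb{N}\cup\{0\}$. $R$ is archimedean if whenever $g,h\in R$ satisfy $kg+h\in R^+$ for all $k\in\mathbb{N}$, then $g\in R^+$. $\mathrm{Loc}(R)$ is the set of $s\in 1+R^+$ such that for all $r\in R$, $rs\in R^+$ implies $r\in R^+$. $R$ is localizable if for every $r\in R$ there is $s\in\mathrm{Loc}(R)$ with $-s\le r\le s$; strongly localizable if $r^2\in R^+$ for all $r$ and $\mathrm{Loc}(R)=1+R^+$. Admissible domains: for a topological space $Y$, an admissible set of domains is a set $\mathcal{D}$ of open subsets of $Y$ with $Y\in\mathcal{D}$ and $A\cap B\in\mathcal{D}$ for $A,B\in\mathcal{D}$. On $\bigcup_{A\in\mathcal{D}}\mathscr{C}(A)$ ($\mathscr{C}(A)$ = continuous real functions on $A$) define $f+g$, $fg$ pointwise on $\operatorname{dom} f\cap\operatorname{dom} g$; $f\approx g$ iff there is $A\in\mathcal{D}$, $A\subseteq\operatorname{dom}f\cap\operatorname{dom}g$,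 with $f|_A=g|_A$. The quotient $\mathscr{C}_\approx(\mathcal{D})$ is a commutative ring, partially ordered by $[f]\le[g]$ iff there is $A\in\mathcal{D}$, $A\subseteq \operatorname{dom}f\cap\operatorname{dom}g$, with $f|_A\le g|_A$ pointwise. $\mathscr{C}_{\mathrm{a.e.}}(X):=\mathscr{C}_\approx(\mathcal{D})$ for $\mathcal{D}$ the set of dense open subsets of $X$. Extended Gelfand transformation: elements of $\mathrm{Loc}(R)$ are non-zero-divisors; the localization $R_{\mathrm{loc}}$ consists of fractions $r/s$ ($r\in R$, $s\in\mathrm{Loc}(R)$), $r/s=r'/s'$ iff $rs'=r's$, with the usual operations, ordered by $p/q\le r/s$ iff $ps\le rq$ in $R$. Let $R^{\mathrm{bd}}_{\mathrm{loc}}=\{a\in R_{\mathrm{loc}}:\exists n\in\mathbb{N}_0,\ -n\le a\le n\}$, a subring with the induced order. $\mathcal{K}(R)$ is the set of ring morphisms $\varphi\colon R^{\mathrm{bd}}_{\mathrm{loc}}\to\mathbb{R}$ with $\varphi(a)\ge0$ for all $a\ge0$, with the weak-$*$ topology (generated by the sets $\{\varphi:\varphi(a)\in V\}$, $a\in R^{\mathrm{bd}}_{\mathrm{loc}}$, $V\subseteq\mathbb{R}$ open). For $s\in\mathrm{Loc}(R)$ put $\mathrm{O}_{s<\infty}=\{\varphi\in\mathcal{K}(R):\varphi(1/s)>0\}$ and $\mathcal{D}_{\mathrm{loc}}(R)=\{\mathrm{O}_{s<\infty}:s\in\mathrm{Loc}(R)\}$ (an admissible set of domains on $\mathcal{K}(R)$).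 For localizable $R$ and $r\in R$, $\widehat r\in\mathscr{C}_\approx(\mathcal{D}_{\mathrm{loc}}(R))$ is the class of $r_s\colon\mathrm{O}_{s<\infty}\to\mathbb{R}$, $\varphi\mapsto\varphi(1/s)^{-1}\varphi(r/s)$, where $s\in\mathrm{Loc}(R)$ is any element with $r/s\in R^{\mathrm{bd}}_{\mathrm{loc}}$ (the class does not depend on the choice of $s$). *)

(* Defs.v *)
From HB Require Import structures.
From mathcomp Require Import all_boot all_order all_algebra.
From mathcomp Require Import all_classical all_reals all_analysis.
From mathcomp Require Import Rstruct Rstruct_topology.


Set Implicit Arguments.
Unset Strict Implicit.
Unset Printing Implicit Defensive.
Import Order.TTheory GRing.Theory Num.Theory.
Local Open Scope classical_set_scope.
Local Open Scope ring_scope.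

Notation Real := Rdefinitions.R.

Definition is_po_ring (A : comPzRingType) (le : A -> A -> Prop) : Prop :=
  (forall r, le r r) /\
  (forall r s, le r s -> le s r -> r = s) /\
  (forall r s t, le r s -> le s t -> le r t) /\
  (forall r s t, le r s -> le (r + t) (s + t)) /\
  (forall r s, le 0 r -> le 0 s -> le 0 (r * s)) /\
  (forall r, le 0 (r * r)).

Definition archimedean_po (A : comPzRingType) (le : A -> A -> Prop) : Prop :=
  forall g h : A, (forall k : nat, (0 < k)%nat -> le 0 (g *+ k + h)) -> le 0 g.

Definition is_loc (A : comPzRingType) (le : A -> A -> Prop) (s : A) : Prop :=
  le 0 (s - 1) /\ (forall r : A, le 0 (r * s) -> le 0 r).

Definition localizable (A : comPzRingType) (le : A -> A -> Prop) : Prop :=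
  forall r : A, exists s : A, [/\ is_loc le s, le (- s) r & le r s].

Definition strongly_localizable (A : comPzRingType) (le : A -> A -> Prop)
  : Prop :=
  (forall r : A, le 0 (r ^+ 2)) /\
  (forall s : A, le 0 (s - 1) -> is_loc le s).

(* The rings C_~(D): an element of C(U) (U an open domain) is          *)
(* represented by a pair (U, f) with f : T -> Real continuous on U     *)
(* (only the restriction f|_U matters).  We never form the quotient;   *)
(* we work with representatives and the relations ~ and <=.            *)
Definition rep (T : Type) := (set T * (T -> Real))%type.

Definition valid_rep (T : topologicalType) (D : set (set T)) (x : rep T)
  : Prop :=
  D x.1 /\ {within x.1, continuous x.2}.

Definition radd (T : Type) (x y : rep T) : rep T :=
  (x.1 `&` y.1, fun t => (x.2 t + y.2 t)).
Definition rmul (T : Type) (x y : rep T) : rep T :=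
  (x.1 `&` y.1, fun t => (x.2 t * y.2 t)).
Definition rcst (T : Type) (Y : set T) (c : Real) : rep T :=
  (Y, fun _ => c).

Definition req (T : Type) (D : set (set T)) (x y : rep T) : Prop :=
  exists U, [/\ D U, U `<=` x.1 `&` y.1 & forall t, U t -> x.2 t = y.2 t].

Definition rle (T : Type) (D : set (set T)) (x y : rep T) : Prop :=
  exists U, [/\ D U, U `<=` x.1 `&` y.1 & forall t, U t -> (x.2 t <= y.2 t)].

Definition dense_open_in (T : topologicalType) (Y : set T) : set (set T) :=
  [set U | [/\ U `<=` Y, (exists V : set T, open V /\ U = V `&` Y)
             & Y `<=` closure U]].

(* the admissible set of domains defining C_a.e.(X) *)
Definition dense_opens (X : topologicalType) : set (set X) :=
  dense_open_in [set: X].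

(* Phi : A -> C_~(D) (given by representatives) is an injective unital  *)
(* ring morphism which is an order embedding; equivalently, A is         *)
(* isomorphic (as a partially ordered ring) to the subring Phi(A) with   *)
(* the induced order.                                                    *)
Definition po_ring_embedding (A : comPzRingType) (le : A -> A -> Prop)
  (T : topologicalType) (Y : set T) (D : set (set T)) (Phi : A -> rep T)
  : Prop :=
  (forall r, valid_rep D (Phi r)) /\
  req D (Phi 1) (rcst Y (1 : Real)) /\
  (forall r s, req D (Phi (r + s)) (radd (Phi r) (Phi s))) /\
  (forall r s, req D (Phi (r * s)) (rmul (Phi r) (Phi s))) /\
  (forall r s, req D (Phi r) (Phi s) -> r = s) /\
  (forall r, le 0 r <-> rle D (rcst Y (0 : Real)) (Phi r)).

(* A fraction r/s of R_loc is represented by the pair (r, s), s in Loc. *)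
Definition frac_eq (A : comPzRingType) (a b : A * A) : Prop :=
  a.1 * b.2 = b.1 * a.2.

Definition bdd_frac (A : comPzRingType) (le : A -> A -> Prop) (a : A * A)
  : Prop :=
  is_loc le a.2 /\
  exists n : nat, le (- (n%:R * a.2)) a.1 /\ le a.1 (n%:R * a.2).

(* The ambient space of all functions on pairs, with the pointwise       *)
(* (product) topology.  A character phi : R^bd_loc -> Real is encoded by *)
(* the function (r, s) |-> phi(r/s) on pairs representing elements of   *)
(* R^bd_loc, and 0 on all other pairs; the subspace topology on K(R)     *)
(* is then exactly the weak-* topology.                                  *)
Definition charspace (A : comPzRingType) := {ptws (A * A)%type -> Real}.

Definition is_char (A : comPzRingType) (le : A -> A -> Prop)
  (phi : charspace A) : Prop :=
  (forall a, ~ bdd_frac le a -> phi a = 0) /\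
  (forall a b, bdd_frac le a -> bdd_frac le b -> frac_eq a b ->
      phi a = phi b) /\
  phi (1, 1) = (1 : Real) /\
  (forall a b, bdd_frac le a -> bdd_frac le b ->
      phi (a.1 * b.2 + b.1 * a.2, a.2 * b.2) = (phi a + phi b)) /\
  (forall a b, bdd_frac le a -> bdd_frac le b ->
      phi (a.1 * b.1, a.2 * b.2) = (phi a * phi b)) /\
  (forall a, bdd_frac le a -> le 0 a.1 -> (0 <= phi a)).

Definition KR (A : comPzRingType) (le : A -> A -> Prop) : set (charspace A) :=
  [set phi | is_char le phi].

Definition Ofin (A : comPzRingType) (le : A -> A -> Prop) (s : A)
  : set (charspace A) :=
  [set phi | KR le phi /\ (0 < phi ((1 : A), s))].

Definition Dloc (A : comPzRingType) (le : A -> A -> Prop)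
  : set (set (charspace A)) :=
  [set U | exists s, is_loc le s /\ U = Ofin le s].

Definition rfun (A : comPzRingType) (r s : A) : charspace A -> Real :=
  fun phi => ((phi ((1 : A), s))^-1 * phi (r, s)).

Definition loc_bound (A : comPzRingType) (le : A -> A -> Prop) (r : A) : A :=
  xget 1 [set s | bdd_frac le (r, s)].

Definition gelfand (A : comPzRingType) (le : A -> A -> Prop) (r : A)
  : rep (charspace A) :=
  (Ofin le (loc_bound le r), rfun r (loc_bound le r)).

Definition gelfand_order_embedding (A : comPzRingType) (le : A -> A -> Prop)
  : Prop :=
  forall r : A,
    le 0 r <-> rle (Dloc le) (rcst (KR le) (0 : Real)) (gelfand le r).

(* Main.v *)
(** For (iii) => (ii), let [r] be not nonnegative and [r/u] bounded.  The
    archimedean property gives [k] such that [b = k r + u s] is not nonnegative.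
    In an archimedean localizable ring [b q >= 1] with [q >= 0] forces [b >= 0],
    so the preordering generated by [A^+] and [- b] is proper and, by Zorn's lemma,
    extends to a total one.  The Dedekind cuts of the fractions with respect to it
    define a character [phi] in [K(R)] with [phi(r/(u s)) <= - 1/k < 0], hence with
    [phi(1/s) > 0] and [phi(r/u) < 0].  Thus [r] is detected already on each
    [O_(s<oo)].  Applied to a bounded element that is negative only near a given
    point of [K(R)], this also shows that [O_(s<oo)] is dense.  Working with total
    preorderings of [A] itself avoids constructing the ring [R_loc]. *)

Require Import Defs.
From HB Require Import structures.
From mathcomp Require Import all_boot all_order all_algebra.
From mathcomp Require Import all_classical all_reals all_analysis.
From mathcomp Require Import Rstruct Rstruct_topology.
From mathcomp Require Import ring lra.

Set Implicit Arguments.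
Unset Strict Implicit.
Unset Printing Implicit Defensive.
Import Order.TTheory GRing.Theory Num.Theory.
Local Open Scope classical_set_scope.
Local Open Scope ring_scope.

Local Notation RR := Rdefinitions.R.

(** * Preorderings and their total extensions *)

Definition preordering (A : comPzRingType) (M : set A) : Prop :=
  [/\ forall x y, M x -> M y -> M (x + y),
      forall x y, M x -> M y -> M (x * y) & forall x, M (x * x)].

(** For a preordering [M] this set is already closed under products, since [c * c] lies in [M]; it
    is then the preordering generated by [M] and [c]. *)
Definition adjoin (A : comPzRingType) (M : set A) (c : A) : set A :=
  [set x | exists p q, [/\ M p, M q & x = p + c * q]].

Section Preordering.
Context (A : comPzRingType) (M : set A) (MP : preordering M).

Lemma preord0 : M 0.
Proof. by case: MP => _ _ /(_ 0); rewrite mul0r. Qed.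

Lemma preord1 : M 1.
Proof. by case: MP => _ _ /(_ 1); rewrite mul1r. Qed.

Lemma preordD x y : M x -> M y -> M (x + y).
Proof. by case: MP => + _ _; exact. Qed.

Lemma preordM x y : M x -> M y -> M (x * y).
Proof. by case: MP => _ + _; exact. Qed.

Lemma preordMn x n : M x -> M (x *+ n).
Proof.
move=> Mx; elim: n => [|n IH]; first by rewrite mulr0n; exact: preord0.
by rewrite mulrS; exact: preordD.
Qed.

Lemma preordX x n : M x -> M (x ^+ n).
Proof.
move=> Mx; elim: n => [|n IH]; first by rewrite expr0; exact: preord1.
by rewrite exprS; exact: preordM.
Qed.

Lemma preord_adjoin c : preordering (adjoin M c).
Proof.
split.
- move=> x y [p [q [Mp Mq ->]]] [p' [q' [Mp' Mq' ->]]].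
  by exists (p + p'), (q + q'); split; [exact: preordD|exact: preordD|ring].
- move=> x y [p [q [Mp Mq ->]]] [p' [q' [Mp' Mq' ->]]].
  exists (p * p' + c * c * (q * q')), (p * q' + p' * q); split; last by ring.
    apply: preordD; first exact: preordM.
    by apply: preordM; [case: MP|exact: preordM].
  by apply: preordD; exact: preordM.
- move=> x; exists (x * x), 0; split; [by case: MP|exact: preord0|ring].
Qed.

Lemma sub_adjoin c : M `<=` adjoin M c.
Proof. by move=> x Mx; exists x, 0; split; [|exact: preord0|ring]. Qed.

Lemma adjoin_mem c : adjoin M c c.
Proof. by exists 0, 1; split; [exact: preord0|exact: preord1|ring]. Qed.

(** From -1 = p + c q and -1 = p' - c q' one gets (c q)(c q') = -(1 + p)(1 + p'), which exhibits -1
    as c^2 q q' + p + p' + p p', an element of [M]. *)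
Lemma adjoin_opp_proper c :
  ~ M (-1) -> ~ adjoin M c (-1) \/ ~ adjoin M (- c) (-1).
Proof.
move=> M1; apply: contrapT => /not_orP[/contrapT[p [q [Mp Mq e]]]].
move=> /contrapT[p' [q' [Mp' Mq' e']]]; apply: M1.
have -> : -1 = c * c * (q * q') + p + p' + p * p' :> A.
  have E : c * q = -1 - p by rewrite e; ring.
  have E' : c * q' = 1 + p'.
    have -> : 1 + p' = p' - (-1) by ring.
    by rewrite e'; ring.
  have -> : c * c * (q * q') = (c * q) * (c * q') by ring.
  by rewrite E E'; ring.
repeat apply: preordD => //; last exact: preordM.
by apply: preordM; [case: MP|exact: preordM].
Qed.

End Preordering.

(* A maximal proper preordering is total by [adjoin_opp_proper]. *)
Lemma total_preordering (A : comPzRingType) (M : set A) :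
  preordering M -> ~ M (-1) ->
  exists N : set A, [/\ M `<=` N, preordering N, ~ N (-1)
    & forall x, N x \/ N (- x)].
Proof.
move=> MP M1.
pose P (N : set A) := N = set0 \/ [/\ M `<=` N, preordering N & ~ N (-1)].
have [F FP Ftot|N [PN Nmax]] := @Zorn_bigcup A P.
  have [->|F0] := pselect (\bigcup_(X in F) X = set0); first by left.
  have good X x : F X -> X x -> [/\ M `<=` X, preordering X & ~ X (-1)].
    by move=> FX Xx; case: (FP _ FX) => // X0; rewrite X0 in Xx.
  right; move/eqP/set0P: F0 => [x0 [X0 FX0 Xx0]].
  have [MX0 X0P _] := good _ _ FX0 Xx0.
  have common x y : (\bigcup_(X in F) X) x -> (\bigcup_(X in F) X) y ->
      exists X, [/\ F X, X x & X y].
    move=> [X FX Xx] [Y FY Yy].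
    case: (Ftot _ _ FX FY) => s; first by exists Y; split=> //; exact: s.
    by exists X; split=> //; exact: s.
  split; first by move=> y My; exists X0 => //; exact: MX0.
    split.
    - move=> x y /common h /h [X [FX Xx Xy]]; exists X => //.
      by have [_ [XD _ _] _] := good _ _ FX Xx; exact: XD.
    - move=> x y /common h /h [X [FX Xx Xy]]; exists X => //.
      by have [_ [_ XM _] _] := good _ _ FX Xx; exact: XM.
    - by move=> x; exists X0 => //; case: X0P.
  by move=> [X FX X1]; have [_ _] := good _ _ FX X1; apply.
have {PN}[MN NP N1] : [/\ M `<=` N, preordering N & ~ N (-1)].
  case: PN => // N0; exfalso; apply: (Nmax M); last by right; split.
  rewrite N0; split=> // h; exact: (h _ (preord0 MP)).
exists N; split=> // x; apply: contrapT => /not_orP[Nx Nx'].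
have key c : ~ N c -> adjoin N c (-1).
  move=> Nc; apply: contrapT => h; apply: (Nmax (adjoin N c)); last first.
    right; split=> //; last exact: preord_adjoin.
    exact: (subset_trans MN (sub_adjoin NP c)).
  by split; [exact: sub_adjoin|move=> h'; apply: Nc; apply: h'; exact: adjoin_mem].
by case: (adjoin_opp_proper NP x N1) => h; apply: h; exact: key.
Qed.

(** * Dedekind cuts of fractions *)

(** Reals given by cuts are identified this way: approximation with denominator [d] leaves an error
    in [d%:R * w] that is bounded independently of [d]. *)
Lemma natmul_bounded_eq0 (w C : RR) :
  (forall d : nat, (0 < d)%N -> `|d%:R * w| <= C) -> w = 0.
Proof.
move=> H; apply/eqP; rewrite -normr_eq0; apply/negP => /negP w0.
have {}w0 : 0 < `|w| by rewrite lt_neqAle eq_sym w0 normr_ge0.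
have /H : (0 < (Num.trunc (C / `|w|)).+1)%N by [].
apply/negP; rewrite -ltNge normrM normr_nat -ltr_pdivrMr //; exact: truncnS_gt.
Qed.

(** The real [x] is the standard part of the fraction a.1/a.2 for the order of [N], compared with
    the rationals n/d after clearing denominators. Only implications from [N] to the reals are
    asked, since infinitesimals can make the converses fail when x = n/d. *)
Definition cut (A : comPzRingType) (N : set A) (a : A * A) (x : RR) : Prop :=
  forall (n : int) (d : nat), (0 < d)%N ->
    (N (a.1 *+ d - a.2 *~ n) -> n%:~R <= d%:R * x) /\
    (N (a.2 *~ n - a.1 *+ d) -> d%:R * x <= n%:~R).

Section Cut.
Context (A : comPzRingType) (N : set A) (NP : preordering N) (N1 : ~ N (-1)).
Context (Ntot : forall x, N x \/ N (- x)).

Let addN x y : N x -> N y -> N (x + y). Proof. exact: preordD. Qed.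
Let mulN x y : N x -> N y -> N (x * y). Proof. exact: preordM. Qed.
Let mulnN x n : N x -> N (x *+ n). Proof. exact: preordMn. Qed.

Lemma preord_ge1 s : N (s - 1) -> N s.
Proof. by move=> h; rewrite -[s](subrK 1); apply: addN => //; exact: preord1. Qed.

(** For n = -(m + 1), adding (m + 1)(s - 1) + m to n s gives -1, so [N] would be improper. *)
Lemma preord_int_ge0 s (n : int) : N (s - 1) -> N (s *~ n) -> 0 <= n.
Proof.
move=> s1; case: n => // m h; exfalso; apply: N1.
have -> : -1 = s *~ (Negz m) + ((s - 1) *+ m.+1 + 1 *+ m).
  by rewrite NegzE; ring.
by apply: addN => //; apply: addN; apply: mulnN => //; exact: preord1.
Qed.

(** By totality the alternative is that - x lies in [N], and then so does x = (- x)(s - 1) + x s. *)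
Lemma preord_cancel s x : N (s - 1) -> N (x * s) -> N x.
Proof.
move=> s1 xs; case: (Ntot x) => // nx.
have -> : x = - x * (s - 1) + x * s by ring.
by apply: addN => //; exact: mulN.
Qed.

(** The real is the supremum of the rationals n/d lying below r/s with respect to [N]; the bound [k]
    makes this set nonempty and bounded above. *)
Lemma cut_exists r s (k : nat) :
  N (s - 1) -> N (s *+ k - r) -> N (r + s *+ k) -> exists x, cut N (r, s) x.
Proof.
move=> s1 hk hk'.
pose E := [set x : RR | exists (n : int) (d : nat),
  [/\ (0 < d)%N, N (r *+ d - s *~ n) & d%:R * x = n%:~R]].
have d0 (d : nat) : (0 < d)%N -> 0 < d%:R :> RR by rewrite ltr0n.
have Eub (n : int) (d : nat) : (0 < d)%N -> N (s *~ n - r *+ d) ->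
    ubound E (n%:~R / d%:R).
  move=> dp hn x [n' [d' [dp' hn' e]]].
  rewrite ler_pdivlMr ?d0 // -(ler_pM2l (d0 _ dp')) mulrA e.
  (* The memberships for the upper fraction n/d and the lower fraction n'/d' are scaled by [d'] and
     [d] and added, so that [r] cancels. *)
  have : 0 <= n * d' - n' * d.
    apply: (preord_int_ge0 s1).
    have -> : s *~ (n * d' - n' * d) =
      (s *~ n - r *+ d) *+ d' + (r *+ d' - s *~ n') *+ d by ring.
    by apply: addN; exact: mulnN.
  rewrite subr_ge0 -(ler_int RR) !intrM.
  by rewrite -!pmulrn [d'%:R * _]mulrC.
have hE : has_sup E.
  split; last first.
    exists (k%:~R / 1%:R); apply: (Eub k%:Z 1%N isT).
    by rewrite mulr1n -pmulrn.
  exists (- k%:R); exists (- k%:Z), 1%N; split=> //.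
    by rewrite mulr1n mulrNz opprK -pmulrn.
  by rewrite mul1r mulrNz.
exists (sup E) => n d dp /=; split => h.
  rewrite -ler_pdivrMl ?d0 //; apply: ub_le_sup; first by case: hE.
  by exists n, d; split=> //; rewrite mulrA divff ?mul1r // gt_eqF ?d0.
rewrite mulrC -ler_pdivlMr ?d0 //; apply: ge_sup; first by case: hE.
exact: Eub.
Qed.

(** With n the floor of d x, totality and the cut property exclude the opposite memberships. The
    lower side needs n - 1: at n the opposite membership only gives d x <= n, which is no
    contradiction when d x = n. *)
Lemma cut_approx r s x d : cut N (r, s) x -> (0 < d)%N ->
  exists n : int, [/\ `|d%:R * x - n%:~R| <= 1 :> RR,
    N (r *+ d - s *~ (n - 1)) & N (s *~ (n + 1) - r *+ d)].
Proof.
move=> hx dp; exists (Num.floor (d%:R * x)).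
have h1 := ge_floor (d%:R * x).
have h2 := floorD1_gt (d%:R * x).
move: (Num.floor (d%:R * x)) h1 h2 => n h1; rewrite intrD => h2.
split; first by rewrite ler_norml; apply/andP; split; lra.
  case: (Ntot (r *+ d - s *~ (n - 1))) => // h.
  have [_ /(_ _)] := hx (n - 1) d dp; rewrite /= -opprB => /(_ h).
  by rewrite intrB => h3; exfalso; lra.
case: (Ntot (s *~ (n + 1) - r *+ d)) => // h.
have [/(_ _) + _] := hx (n + 1) d dp; rewrite /= -opprB => /(_ h).
by rewrite intrD => h3; exfalso; lra.
Qed.

(** After multiplication by d both reals are within 1 of the same integer, so they differ by at most
    2/d. *)
Lemma cut_unique a x y : cut N a x -> cut N a y -> x = y.
Proof.
case: a => r s hx hy; apply/eqP; rewrite -subr_eq0; apply/eqP.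
apply: (@natmul_bounded_eq0 _ 2) => d dp.
have [n [+ h1 h2]] := cut_approx hx dp.
have [/(_ h1) + _] := hy (n - 1) d dp; have [_ /(_ h2)] := hy (n + 1) d dp.
rewrite intrD intrB mulrBr.
rewrite !ler_norml => h3 h4 /andP[h5 h6]; apply/andP; split; lra.
Qed.

(** The test elements of the two pairs agree after multiplication by s' and s respectively, and
    [preord_cancel] removes the factor. *)
Lemma cut_frac_eq r s r' s' x : N (s - 1) -> r * s' = r' * s ->
  cut N (r, s) x -> N (s' - 1) -> cut N (r', s') x.
Proof.
move=> s1 e hx s1' n d dp; have [h1 h2] := hx n d dp; split=> /= h.
  apply: h1; apply: (preord_cancel s1') => /=.
  have -> : (r *+ d - s *~ n) * s' = (r' *+ d - s' *~ n) * s.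
    transitivity ((r * s') *+ d - s * s' *~ n); first by ring.
    by rewrite e; ring.
  by apply: mulN => //; exact: preord_ge1.
apply: h2; apply: (preord_cancel s1') => /=.
have -> : (s *~ n - r *+ d) * s' = (s' *~ n - r' *+ d) * s.
  transitivity (s * s' *~ n - (r * s') *+ d); first by ring.
  by rewrite e; ring.
by apply: mulN => //; exact: preord_ge1.
Qed.

Lemma cut1 : cut N (1, 1) 1.
Proof.
have N11 : N (1 - 1) by rewrite subrr; exact: preord0.
move=> n d dp /=; split => h.
  have : 0 <= d%:Z - n.
    apply: (preord_int_ge0 N11).
    by have -> : 1 *~ (d%:Z - n) = 1 *+ d - 1 *~ n :> A by ring.
  by rewrite subr_ge0 -(ler_int RR) mulr1.
have : 0 <= n - d%:Z.
  apply: (preord_int_ge0 N11).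
  by have -> : 1 *~ (n - d%:Z) = 1 *~ n - 1 *+ d :> A by ring.
by rewrite subr_ge0 -(ler_int RR) mulr1.
Qed.

Lemma cut_ge0 r s x : cut N (r, s) x -> N r -> 0 <= x.
Proof.
move=> hx hr; have [/(_ _) + _] := hx 0 1%N isT.
by rewrite /= mulr0z subr0 mulr1n mul1r; exact.
Qed.

(** Adding the approximations of both fractions puts d z within 2 of n + n', and d x + d x' is
    within 2 of it as well; hence the constant 4. *)
Lemma cutD r s r' s' x x' z : N (s - 1) -> N (s' - 1) ->
  cut N (r, s) x -> cut N (r', s') x' ->
  cut N (r * s' + r' * s, s * s') z -> z = x + x'.
Proof.
move=> s1 s1' hx hx' hz; apply/eqP; rewrite -subr_eq0; apply/eqP.
apply: (@natmul_bounded_eq0 _ 4) => d dp.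
have [n [+ h1 h2]] := cut_approx hx dp.
have [n' [+ h1' h2']] := cut_approx hx' dp.
have Ns := preord_ge1 s1; have Ns' := preord_ge1 s1'.
have [/(_ _) + _] := hz (n + n' - 2) d dp.
have [_ /(_ _)] := hz (n + n' + 2) d dp => /=.
have -> : s * s' *~ (n + n' + 2) - (r * s' + r' * s) *+ d =
  (s *~ (n + 1) - r *+ d) * s' + (s' *~ (n' + 1) - r' *+ d) * s by ring.
have -> : (r * s' + r' * s) *+ d - s * s' *~ (n + n' - 2) =
  (r *+ d - s *~ (n - 1)) * s' + (r' *+ d - s' *~ (n' - 1)) * s by ring.
move=> h3 h4; have {}h3 := h3 (addN (mulN h2 Ns') (mulN h2' Ns)).
have {}h4 := h4 (addN (mulN h1 Ns') (mulN h1' Ns)).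
move: h3 h4; rewrite !(intrD, intrB) => h3 h4.
rewrite mulrBr mulrDr.
rewrite !ler_norml => /andP[h5 h6] /andP[h7 h8]; apply/andP; split; lra.
Qed.

(** For m >= 0 both summands are nonnegative; for m < 0 the sum is |m| (2 t - y). This controls the
    cross terms in [cutM]. *)
Lemma preord_sandwich y t (m : int) :
  N y -> N (t *+ 2 - y) -> N (y *~ m + t *+ (2 * `|m|)%N).
Proof.
move=> h1 h2; case: m => m; last first.
  have -> : y *~ Negz m + t *+ (2 * `|Negz m|)%N = (t *+ 2 - y) *+ m.+1.
    by rewrite NegzE abszN absz_nat mulrNz -pmulrn mulrnA mulrnBl addrC.
  exact: mulnN.
rewrite absz_nat -pmulrn mulrnA; apply: addN; apply: mulnN => //.
by rewrite -(subrK y (t *+ 2)); exact: addN.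
Qed.

(** The real estimate behind [cutM]: d^2 z and d^2 a b are both compared with m m', where |m| and
    |m'| are at most d |a| + 2 and d |b| + 2. The resulting bound is only linear in d. *)
Lemma mul_approx_bound (d a b z m m' am am' : RR) : 0 < d ->
  am = `|m| -> am' = `|m'| ->
  d * d * z <= m * m' + 2 * am + 2 * am' + 4 ->
  m * m' - 2 * am - 2 * am' <= d * d * z ->
  `|d * a - (m + 1)| <= 1 -> `|d * b - (m' + 1)| <= 1 ->
  `|d * d * (z - a * b)| <= 4 * d * (`|a| + `|b|) + 16.
Proof.
move=> d0 -> -> h1 h2 h3 h4.
have e1 : `|m - d * a| <= 2.
  by move: h3; rewrite !ler_norml => /andP[? ?]; apply/andP; split; lra.
have e2 : `|m' - d * b| <= 2.
  by move: h4; rewrite !ler_norml => /andP[? ?]; apply/andP; split; lra.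
have f1 : `|m| <= d * `|a| + 2.
  rewrite -[m](subrK (d * a)); apply: (le_trans (ler_normD _ _)).
  by rewrite normrM (gtr0_norm d0) addrC lerD.
have f2 : `|m'| <= d * `|b| + 2.
  rewrite -[m'](subrK (d * b)); apply: (le_trans (ler_normD _ _)).
  by rewrite normrM (gtr0_norm d0) addrC lerD.
have g : `|m * m' - d * d * (a * b)| <= 2 * `|m'| + 2 * (d * `|a|).
  have -> : m * m' - d * d * (a * b) =
    (m - d * a) * m' + (m' - d * b) * (d * a) by ring.
  apply: (le_trans (ler_normD _ _)); rewrite !normrM (gtr0_norm d0).
  by apply: lerD; apply: ler_wpM2r => //; rewrite mulr_ge0 // ltW.
move: g; rewrite mulrBr !ler_norml => /andP[g1 g2]; apply/andP; split; lra.
Qed.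

(** Write r d = U + s m and r' d = U' + s' m' with remainders 0 <= U <= 2 s and 0 <= U' <= 2 s'.
    Expanding the product compares d^2 z with m m' up to an error linear in d, and dividing by d
    leaves a bound independent of d. *)
Lemma cutM r s r' s' x x' z : N (s - 1) -> N (s' - 1) ->
  cut N (r, s) x -> cut N (r', s') x' ->
  cut N (r * r', s * s') z -> z = x * x'.
Proof.
move=> s1 s1' hx hx' hz; apply/eqP; rewrite -subr_eq0; apply/eqP.
apply: (@natmul_bounded_eq0 _ (4 * (`|x| + `|x'|) + 16)) => d dp.
have d0 : 1 <= d%:R :> RR by rewrite (ler_nat _ 1).
have Ns := preord_ge1 s1; have Ns' := preord_ge1 s1'.
have [n [+ h1 h2]] := cut_approx hx dp.
have [n' [+ h1' h2']] := cut_approx hx' dp.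
(* [cut_approx] brackets r d between s (n - 1) and s (n + 1); the shift to n - 1 makes the
   remainders nonnegative. *)
pose m := n - 1; pose m' := n' - 1.
pose U := r *+ d - s *~ m; pose U' := r' *+ d - s' *~ m'.
have hU2 : N (s *+ 2 - U).
  by move: h2; congr (N _); rewrite /U /m; ring.
have hU2' : N (s' *+ 2 - U').
  by move: h2'; congr (N _); rewrite /U' /m'; ring.
have sand k : N (s * U' *~ k + (s * s') *+ (2 * `|k|)%N).
  apply: preord_sandwich; first exact: mulN.
  have -> : s * s' *+ 2 - s * U' = s * (s' *+ 2 - U') by ring.
  exact: mulN.
have sand' k : N (s' * U *~ k + (s * s') *+ (2 * `|k|)%N).
  apply: preord_sandwich; first exact: mulN.
  have -> : s * s' *+ 2 - s' * U = s' * (s *+ 2 - U) by ring.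
  exact: mulN.
have dp2 : (0 < d * d)%N by rewrite muln_gt0 dp.
have [/(_ _) lo _] := hz (m * m' - 2 * `|m|%N%:Z - 2 * `|m'|%N%:Z) _ dp2.
have [_ /(_ _) hi] := hz (m * m' + 2 * `|m|%N%:Z + 2 * `|m'|%N%:Z + 4) _ dp2.
move=> a1 a2.
have rE : r *+ d = U + s *~ m by rewrite subrK.
have rE' : r' *+ d = U' + s' *~ m' by rewrite subrK.
have rrE : (r * r') *+ (d * d) = (U + s *~ m) * (U' + s' *~ m').
  by rewrite -rE -rE' mulrnAl mulrnAr mulrnA.
have {}lo : (m * m' - 2 * `|m|%N%:Z - 2 * `|m'|%N%:Z)%:~R <=
    (d * d)%:R * z :> RR.
  apply: lo => /=; rewrite rrE.
  have -> : (U + s *~ m) * (U' + s' *~ m') -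
      s * s' *~ (m * m' - 2 * `|m|%N%:Z - 2 * `|m'|%N%:Z) =
    U * U' + (s * U' *~ m + (s * s') *+ (2 * `|m|)%N) +
      (s' * U *~ m' + (s * s') *+ (2 * `|m'|)%N).
    by move: (`|m|)%N (`|m'|)%N => k k'; ring.
  by apply: addN => //; apply: addN => //; exact: mulN.
have {}hi : (d * d)%:R * z <=
    (m * m' + 2 * `|m|%N%:Z + 2 * `|m'|%N%:Z + 4)%:~R :> RR.
  apply: hi => /=; rewrite rrE.
  have := sand' (- m'); have := sand (- m); rewrite !abszN.
  (* The constant 4 accounts for U U', since 4 s s' - U U' = (2 s - U) U' + 2 s (2 s' - U'). *)
  have -> : s * s' *~ (m * m' + 2 * `|m|%N%:Z + 2 * `|m'|%N%:Z + 4) -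
      (U + s *~ m) * (U' + s' *~ m') =
    (s *+ 2 - U) * U' + (s *+ 2) * (s' *+ 2 - U') +
    (s * U' *~ (- m) + (s * s') *+ (2 * `|m|)%N) +
      (s' * U *~ (- m') + (s * s') *+ (2 * `|m'|)%N).
    by move: (`|m|)%N (`|m'|)%N => k k'; ring.
  move=> b1 b2; apply: addN => //; apply: addN => //; apply: addN.
    exact: mulN.
  by apply: mulN => //; exact: mulnN.
have main : `|d%:R * d%:R * (z - x * x')| <= 4 * d%:R * (`|x| + `|x'|) + 16.
  apply: (@mul_approx_bound _ _ _ _ m%:~R m'%:~R `|m|%N%:R `|m'|%N%:R).
  - exact: lt_le_trans d0.
  - by rewrite -intr_norm -abszE.
  - by rewrite -intr_norm -abszE.
  - by move: hi; rewrite natrM; congr (_ <= _); ring.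
  - by move: lo; rewrite natrM; congr (_ <= _); ring.
  - by rewrite /m intrB subrK.
  - by rewrite /m' intrB subrK.
(* One factor [d] is divided out; as d >= 1, the constant 16 is absorbed by 16 d. *)
have dd0 : 0 < d%:R :> RR by exact: lt_le_trans d0.
rewrite -(ler_pM2l dd0) -[X in X * _ <= _](gtr0_norm dd0) -normrM mulrA.
apply: (le_trans main); move: (`|x| + `|x'|) => w.
by rewrite mulrDr; apply: lerD; [lra|rewrite ler_peMl].
Qed.
End Cut.

(** * Separation by characters *)

Section PartiallyOrdered.
Context (A : comPzRingType) (le : A -> A -> Prop) (Hpo : is_po_ring le).

Lemma po_subr r s : le r s <-> le 0 (s - r).
Proof.
case: Hpo => _ [_] [_] [leD _]; split => h.
  by have := leD _ _ (- r) h; rewrite subrr.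
by have := leD _ _ r h; rewrite add0r subrK.
Qed.

Lemma po_preordering : preordering [set x | le 0 x].
Proof.
case: Hpo => _ [_] [leT] [leD] [leM leS]; split=> //= x y x0 y0.
by apply: (leT _ y) => //; have := leD _ _ y x0; rewrite add0r.
Qed.

Let addP x y : le 0 x -> le 0 y -> le 0 (x + y).
Proof. exact: (preordD po_preordering). Qed.
Let mulP x y : le 0 x -> le 0 y -> le 0 (x * y).
Proof. exact: (preordM po_preordering). Qed.
Let mulnP x n : le 0 x -> le 0 (x *+ n).
Proof. exact: (preordMn po_preordering). Qed.
Let pos1 : le 0 1. Proof. exact: (preord1 po_preordering). Qed.
Let pos0 : le 0 0. Proof. exact: (preord0 po_preordering). Qed.

Lemma is_loc_ge0 s : is_loc le s -> le 0 s.
Proof. by move=> [s1 _]; rewrite -(subrK 1 s); exact: addP. Qed.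

Lemma is_loc1 : is_loc le 1.
Proof. by split=> [|r]; [rewrite subrr|rewrite mulr1]. Qed.

Lemma is_locM s t : is_loc le s -> is_loc le t -> is_loc le (s * t).
Proof.
move=> ls lt; have s0 := is_loc_ge0 ls; have t0 := is_loc_ge0 lt.
case: ls lt => [s1 sc] [t1 tc]; split=> [|r]; last by rewrite mulrA => /tc /sc.
have -> : s * t - 1 = (s - 1) * t + (t - 1) by ring.
by apply: addP => //; exact: mulP.
Qed.

Lemma is_locX s n : is_loc le s -> is_loc le (s ^+ n).
Proof.
move=> ls; elim: n => [|n IH]; first by rewrite expr0; exact: is_loc1.
by rewrite exprS; exact: is_locM.
Qed.

Lemma bdd_fracP r s : bdd_frac le (r, s) <->
  is_loc le s /\ exists n, le 0 (s *+ n - r) /\ le 0 (r + s *+ n).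
Proof.
split=> -[ls [n [h1 h2]]]; split=> //; exists n; move: h1 h2 => /=.
  move=> /po_subr + /po_subr; rewrite mulr_natl opprK; by split.
by split; apply/po_subr; rewrite mulr_natl ?opprK.
Qed.

Lemma bdd_fracD a b : bdd_frac le a -> bdd_frac le b ->
  bdd_frac le (a.1 * b.2 + b.1 * a.2, a.2 * b.2).
Proof.
case: a b => [r s] [r' s'] /bdd_fracP[ls [n [h1 h2]]] /bdd_fracP[ls' [n' [h1' h2']]].
have s0 := is_loc_ge0 ls; have s0' := is_loc_ge0 ls'.
apply/bdd_fracP; split; first exact: is_locM.
exists (n + n')%N; split=> /=.
  have -> : s * s' *+ (n + n') - (r * s' + r' * s) =
    (s *+ n - r) * s' + (s' *+ n' - r') * s by ring.
  by apply: addP; exact: mulP.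
have -> : r * s' + r' * s + s * s' *+ (n + n') =
    (r + s *+ n) * s' + (r' + s' *+ n') * s by ring.
by apply: addP; exact: mulP.
Qed.

(* The constant 3 avoids a division by 2, which need not preserve positivity in [A]. *)
Lemma bdd_fracM a b : bdd_frac le a -> bdd_frac le b ->
  bdd_frac le (a.1 * b.1, a.2 * b.2).
Proof.
case: a b => [r s] [r' s'] /bdd_fracP[ls [n [h1 h2]]] /bdd_fracP[ls' [n' [h1' h2']]].
have s0 := is_loc_ge0 ls; have s0' := is_loc_ge0 ls'.
apply/bdd_fracP; split; first exact: is_locM.
exists (3 * (n * n'))%N; split=> /=.
  have -> : s * s' *+ (3 * (n * n')) - r * r' =
    (s *+ n - r) * (r' + s' *+ n') + (s *+ n) * (s' *+ n' - r')
      + (s' *+ n') * (r + s *+ n) by ring.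
  by apply: addP; [apply: addP|]; apply: mulP => //; exact: mulnP.
have -> : r * r' + s * s' *+ (3 * (n * n')) =
    (r + s *+ n) * (r' + s' *+ n') + (s *+ n) * (s' *+ n' - r')
      + (s' *+ n') * (s *+ n - r) by ring.
by apply: addP; [apply: addP|]; apply: mulP => //; exact: mulnP.
Qed.

Lemma bdd_frac_inv s : is_loc le s -> bdd_frac le (1, s).
Proof.
move=> ls; apply/bdd_fracP; split=> //; exists 1%N; rewrite mulr1n.
by split; [case: ls|apply: addP => //; exact: is_loc_ge0].
Qed.

Lemma bdd_frac_diag s : is_loc le s -> bdd_frac le (s, s).
Proof.
move=> ls; have s0 := is_loc_ge0 ls.
apply/bdd_fracP; split=> //; exists 1%N; rewrite mulr1n subrr.
by split=> //; exact: addP.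
Qed.

Lemma bdd_frac0 s : is_loc le s -> bdd_frac le (0, s).
Proof.
by move=> ls; apply/bdd_fracP; split=> //; exists 0%N; rewrite mulr0n subr0 addr0.
Qed.

Lemma bdd_frac_addl r r' s : bdd_frac le (r, s) -> bdd_frac le (r', s) ->
  bdd_frac le (r + r', s).
Proof.
move=> /bdd_fracP[ls [n [h1 h2]]] /bdd_fracP[_ [n' [h1' h2']]].
apply/bdd_fracP; split=> //; exists (n + n')%N; split.
  have -> : s *+ (n + n') - (r + r') = (s *+ n - r) + (s *+ n' - r') by ring.
  exact: addP.
have -> : r + r' + s *+ (n + n') = (r + s *+ n) + (r' + s *+ n') by ring.
exact: addP.
Qed.

Lemma bdd_frac_opp r s : bdd_frac le (r, s) -> bdd_frac le (- r, s).
Proof.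
move=> /bdd_fracP[ls [n [h1 h2]]]; apply/bdd_fracP; split=> //; exists n.
by rewrite opprK addrC [- r + _]addrC.
Qed.

Lemma bdd_frac_mulz r s (k : int) : bdd_frac le (r, s) -> bdd_frac le (r *~ k, s).
Proof.
move=> h; have ls : is_loc le s by case: h.
have hn (m : nat) : bdd_frac le (r *+ m, s).
  elim: m => [|m IH]; first by rewrite mulr0n; exact: bdd_frac0.
  by rewrite mulrS; exact: bdd_frac_addl.
case: k => m; first by rewrite -pmulrn.
by rewrite NegzE mulrNz -pmulrn; exact: bdd_frac_opp.
Qed.

Lemma localizable_bdd_frac r : localizable le -> exists s, bdd_frac le (r, s).
Proof.
move=> /(_ r) [s [ls /po_subr h1 /po_subr h2]]; exists s.
apply/bdd_fracP; split=> //; exists 1%N; rewrite mulr1n; split=> //.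
by rewrite opprK in h1.
Qed.

(* With [w, t] in [Loc], [- w <= b <= w] and [q <= t], induction on [n] gives
   [t^n b + (t - q)^n w >= 0].  As [1 <= b q <= w q], this and the Bernoulli type
   bound [(n+1) q (t - q)^n <= t^(n+1)] yield [(n+1) b + w^2 t >= 0]. *)
Lemma nonneg_of_mul_ge1 b q : archimedean_po le -> localizable le ->
  le 0 q -> le 0 (b * q - 1) -> le 0 b.
Proof.
move=> arch loc q0 bq1.
have [w [lw /po_subr + /po_subr wb]] := loc b; rewrite opprK => bw.
have [t [lt _ /po_subr tq]] := loc q.
have w0 := is_loc_ge0 lw; have t0 := is_loc_ge0 lt.
have bq0 : le 0 (b * q) by rewrite -(subrK 1 (b * q)); exact: addP.
have tX n : le 0 (t ^+ n) by exact: (preordX po_preordering).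
have uX n : le 0 ((t - q) ^+ n) by exact: (preordX po_preordering).
have lower n : le 0 (t ^+ n * b + (t - q) ^+ n * w).
  elim: n => [|n IH]; first by rewrite !expr0 !mul1r.
  have -> : t ^+ n.+1 * b + (t - q) ^+ n.+1 * w =
    (t ^+ n * b + (t - q) ^+ n * w) * (t - q) + t ^+ n * (b * q).
    by rewrite !exprS; ring.
  by apply: addP; apply: mulP.
have wq1 : le 0 (w * q - 1).
  have -> : w * q - 1 = (w - b) * q + (b * q - 1) by ring.
  by apply: addP => //; exact: mulP.
have bern n : le 0 (t ^+ n.+1 - (t - q) ^+ n.+1 - (q * (t - q) ^+ n) *+ n.+1).
  elim: n => [|n IH].
    by rewrite !expr1 expr0 mulr1n mulr1; have -> : t - (t - q) - q = 0 by ring.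
  have -> : t ^+ n.+2 - (t - q) ^+ n.+2 - (q * (t - q) ^+ n.+1) *+ n.+2 =
      (t ^+ n.+1 - (t - q) ^+ n.+1 - (q * (t - q) ^+ n) *+ n.+1) * t
      + ((q * (t - q) ^+ n) * q) *+ n.+1.
    by rewrite !exprS [n.+2]lock -lock [_ *+ n.+2]mulrS; ring.
  by apply: addP; [exact: mulP|apply: mulnP; apply: mulP => //; exact: mulP].
apply: (arch b (w * w * t)) => -[//|n] _.
have [_ cancel] := is_locX n lt; apply: cancel.
(* The error (n+1) (t - q)^n w from [lower] is at most (n+1) q (t - q)^n w^2 because w q >= 1, and
   this is at most w^2 t^(n+1) by [bern]. After cancelling t^n the remaining bound w^2 t does not
   depend on n. *)
have -> : (b *+ n.+1 + w * w * t) * t ^+ n =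
  (t ^+ n * b + (t - q) ^+ n * w) *+ n.+1
  + ((t - q) ^+ n * w * (w * q - 1)) *+ n.+1
  + w * w * (t ^+ n.+1 - (t - q) ^+ n.+1 - (q * (t - q) ^+ n) *+ n.+1)
  + w * w * (t - q) ^+ n.+1.
  by rewrite exprS; ring.
apply: addP; last by apply: mulP => //; exact: mulP.
apply: addP; last by apply: mulP => //; exact: mulP.
by apply: addP; apply: mulnP => //; apply: mulP => //; exact: mulP.
Qed.

(** The default 0 is the value that [is_char] prescribes on pairs that are not bounded fractions. *)
Definition order_char (N : set A) : charspace A :=
  fun a => xget 0 [set x | bdd_frac le a /\ cut N a x].

Section OrderChar.
Context (N : set A) (NP : preordering N) (N1 : ~ N (-1)).
Context (Ntot : forall x, N x \/ N (- x)) (posN : forall x, le 0 x -> N x).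

Lemma order_char_cut a : bdd_frac le a -> cut N a (order_char N a).
Proof.
case: a => r s ba; rewrite /order_char.
have [[s1 _] [k [h1 h2]]] := (bdd_fracP _ _).1 ba.
have [x hx] := cut_exists NP N1 (posN s1) (posN h1) (posN h2).
by case: xgetP => [y _ [] //|/(_ x) []].
Qed.

Lemma order_char_is_char : is_char le (order_char N).
Proof.
have geN s : is_loc le s -> N (s - 1) by move=> [s1 _]; exact: posN.
have bl a : bdd_frac le a -> N (a.2 - 1) by move=> [/geN].
split; first by move=> a na; rewrite /order_char xgetPN // => x [].
split.
  move=> [r s] [r' s'] ba bb e; apply: (cut_unique Ntot (a := (r', s'))).
    apply: (cut_frac_eq NP Ntot (bl _ ba) e _ (bl _ bb)).
    exact: order_char_cut.
  exact: order_char_cut.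
split.
  apply: (cut_unique Ntot (a := (1, 1))); last exact: cut1.
  apply: order_char_cut; exact: bdd_frac_diag is_loc1.
split.
  move=> [r s] [r' s'] ba bb; apply: (cutD NP Ntot (bl _ ba) (bl _ bb));
    apply: order_char_cut => //; exact: (bdd_fracD ba bb).
split.
  move=> [r s] [r' s'] ba bb; apply: (cutM NP Ntot (bl _ ba) (bl _ bb));
    apply: order_char_cut => //; exact: (bdd_fracM ba bb).
by move=> [r s] ba /posN; apply: cut_ge0; exact: order_char_cut.
Qed.

End OrderChar.

(** The character is made negative at r/(u s) rather than at r/u only: this value is the product of
    phi(r/u) and phi(1/s) >= 0, so a single strict inequality yields both phi(1/s) > 0 and phi(r/u)
    < 0. *)
Lemma separating_char r u s : archimedean_po le -> localizable le ->
  bdd_frac le (r, u) -> is_loc le s -> ~ le 0 r ->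
  exists2 phi, Ofin le s phi & phi (r, u) < 0.
Proof.
move=> arch loc br ls nr; have lu : is_loc le u by case: br.
have [k [k0 nb]] : exists k, (0 < k)%N /\ ~ le 0 (r *+ k + u * s).
  apply: contrapT => h; apply: nr; apply: (arch r (u * s)) => k k0.
  by apply: contrapT => h'; apply: h; exists k.
set b := r *+ k + u * s in nb.
(* An equation -1 = p - b q with p, q >= 0 says b q >= 1, which forces b >= 0 by
   [nonneg_of_mul_ge1]. *)
have prop : ~ adjoin [set x | le 0 x] (- b) (-1).
  move=> [p [q [p0 q0 e]]]; apply: nb; apply: (nonneg_of_mul_ge1 arch loc q0).
  suff -> : b * q - 1 = p by [].
  have -> : b * q - 1 = b * q + (p + - b * q) by rewrite -e.
  by ring.
have [N [adjN NP N1 Ntot]] := total_preordering (preord_adjoin po_preordering (- b)) prop.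
have posN x : le 0 x -> N x.
  by move=> x0; apply: adjN; exact: (sub_adjoin po_preordering).
have nbN : N (- b) by apply: adjN; exact: (adjoin_mem po_preordering).
pose phi := order_char N.
have ch : is_char le phi by exact: order_char_is_char.
have bs := bdd_frac_inv ls.
have bru := bdd_fracM br bs; rewrite /= mulr1 in bru.
(* Membership of - b = - (u s) - k r in [N] is the upper test of the cut at the rational -1/k. *)
have neg : phi (r, u * s) < 0.
  have [_ h] := order_char_cut NP N1 posN bru (-1) k0.
  have {}h : k%:R * phi (r, u * s) <= (-1)%:~R.
    by apply: h; move: nbN; congr (N _); rewrite /b /=; ring.
  rewrite -(pmulr_rlt0 _ (x := k%:R)) ?ltr0n //; apply: (le_lt_trans h).
  by rewrite ltrN10.
case: (ch) => _ [_] [_] [_] [phiM phi_ge0].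
have s0 : 0 <= phi (1, s) by exact: (phi_ge0 (1, s)).
have := phiM _ _ br bs; rewrite /= mulr1 => e; rewrite e in neg.
have sp : 0 < phi (1, s).
  rewrite lt_neqAle s0 andbT eq_sym; apply/eqP => z.
  by move: neg; rewrite z mulr0 ltxx.
by exists phi => //; rewrite -(pmulr_llt0 _ sp).
Qed.

End PartiallyOrdered.

(** * The character space *)

(** The trace of the neighbourhood filter on [W] is proper because x is in the closure, so
    inequalities pass to limits along it. *)
Lemma le_closure (T : topologicalType) (W : set T) (f g : T -> RR) x :
  closure W x -> f @ within W (nbhs x) --> f x ->
  g @ within W (nbhs x) --> g x -> (forall y, W y -> f y <= g y) -> f x <= g x.
Proof.
move=> /within_nbhs_proper PW cf cg fg; apply: ler_cvg_to cf cg _.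
by apply: (filterS fg); exact: withinT.
Qed.

(** Needed because statement (i) asks for a compact space, whereas K(R) is obtained as a compact
    subset of [charspace]. *)
Lemma compact_set_type (T : topologicalType) (K : set T) :
  compact K -> compact [set: set_type K].
Proof.
move=> cK F PF _.
have [|p [Kp clp]] := cK (set_val @ F) (fmap_proper_filter _ PF).
  by apply: (@filterS _ F _ setT) => [x _|]; [exact: set_valP|exact: filterT].
exists (exist _ p (mem_set Kp)); split=> // S U FS [B [[W oW <-] Wp] WU].
have [||_ [[x Sx <-] Wx]] := clp (set_val @` S) W.
- by apply: (@filterS _ F _ S) FS => x Sx; exists x.
- by apply: open_nbhs_nbhs; split.
by exists x; split=> //; exact: WU.
Qed.

Lemma closure_set_type (T : topologicalType) (K W : set T) (x : set_type K) :
  W `<=` K -> closure W (set_val x) -> closure (set_val @^-1` W) x.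
Proof.
move=> WK clW U [B [[G oG <-] Gx GU]].
have [|y [Wy Gy]] := clW G; first exact: open_nbhs_nbhs.
by exists (exist _ y (mem_set (WK _ Wy))); split=> //; exact: GU.
Qed.

Section Characters.
Context (A : comPzRingType) (le : A -> A -> Prop) (Hpo : is_po_ring le).
Implicit Types (phi : charspace A) (r s t : A).

Lemma eval_continuous (a : A * A) : continuous (fun phi : charspace A => phi a).
Proof. exact: (@proj_continuous _ (fun=> RR) a). Qed.

Lemma eval_continuous_set_type (K : set (charspace A)) (a : A * A) :
  continuous (fun x : set_type K => set_val x a).
Proof.
move=> x; apply: (@continuous_comp (set_type K) (charspace A) RR set_val
  (fun phi => phi a)); last exact: eval_continuous.
exact: initial_continuous.
Qed.

Lemma charD phi a b : KR le phi -> bdd_frac le a -> bdd_frac le b ->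
  phi (a.1 * b.2 + b.1 * a.2, a.2 * b.2) = phi a + phi b.
Proof. by case=> _ [_] [_] [+ _]; exact. Qed.

Lemma charM phi a b : KR le phi -> bdd_frac le a -> bdd_frac le b ->
  phi (a.1 * b.1, a.2 * b.2) = phi a * phi b.
Proof. by case=> _ [_] [_] [_] [+ _]; exact. Qed.

Lemma char_frac_eq phi a b : KR le phi -> bdd_frac le a -> bdd_frac le b ->
  a.1 * b.2 = b.1 * a.2 -> phi a = phi b.
Proof. by case=> _ [+ _]; exact. Qed.

Lemma char_ge0 phi r s : KR le phi -> bdd_frac le (r, s) -> le 0 r ->
  0 <= phi (r, s).
Proof. by case=> _ [_] [_] [_] [_] h ba; exact: (h (r, s)). Qed.

Lemma char_addl phi r r' s : KR le phi -> bdd_frac le (r, s) ->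
  bdd_frac le (r', s) -> phi (r + r', s) = phi (r, s) + phi (r', s).
Proof.
move=> K b b'; rewrite -(charD K b b') /=.
apply: char_frac_eq => //=; [exact: bdd_frac_addl|exact: (bdd_fracD Hpo b b')|].
by ring.
Qed.

Lemma char0 phi s : KR le phi -> is_loc le s -> phi (0, s) = 0.
Proof.
move=> K ls; have b := bdd_frac0 Hpo ls; have := char_addl K b b.
by rewrite addr0 => e; lra.
Qed.

Lemma char_opp phi r s : KR le phi -> bdd_frac le (r, s) ->
  phi (- r, s) = - phi (r, s).
Proof.
move=> K b; have := char_addl K b (bdd_frac_opp Hpo b).
by rewrite subrr char0 //; [move=> e; lra|case: b].
Qed.

Lemma char_mulz phi r s (k : int) : KR le phi -> bdd_frac le (r, s) ->
  phi (r *~ k, s) = k%:~R * phi (r, s).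
Proof.
move=> K b; have ls : is_loc le s by case: b.
have hn (m : nat) : phi (r *+ m, s) = m%:R * phi (r, s).
  elim: m => [|m IH]; first by rewrite mulr0n char0 // mul0r.
  rewrite mulrS char_addl // ?IH; first by rewrite mulrS mulrDl mul1r.
  by rewrite pmulrn; exact: bdd_frac_mulz.
case: k => m; first by rewrite -!pmulrn hn.
rewrite NegzE !mulrNz -!pmulrn char_opp ?hn ?mulNr //.
by rewrite pmulrn; exact: bdd_frac_mulz.
Qed.

Lemma char_diag phi s : KR le phi -> is_loc le s -> phi (s, s) = 1.
Proof.
move=> K ls; have <- : phi (1, 1) = 1 by case: (K) => _ [_] [].
apply: char_frac_eq => //=; last exact: mulrC.
  exact: bdd_frac_diag.
by apply: bdd_frac_diag => //; exact: is_loc1.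
Qed.

(** The bound is uniform in [phi], which places K(R) inside a product of compact intervals, ready
    for Tychonoff's theorem. *)
Lemma char_bound (a : A * A) :
  exists n : nat, forall phi, KR le phi -> - n%:R <= phi a <= n%:R.
Proof.
have [ba|nba] := pselect (bdd_frac le a); last first.
  by exists 0%N => phi [/(_ _ nba) -> _]; rewrite mulr0n oppr0 lexx.
case: a ba => r s ba; have [ls [n [h1 h2]]] := (bdd_fracP Hpo _ _).1 ba.
exists n => phi K; have bs := bdd_frac_mulz Hpo n (bdd_frac_diag Hpo ls).
have := char_ge0 K (bdd_frac_addl Hpo bs (bdd_frac_opp Hpo ba)) h1.
have := char_ge0 K (bdd_frac_addl Hpo ba bs) h2.
rewrite (char_addl K bs (bdd_frac_opp Hpo ba)) (char_addl K ba bs).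
rewrite (char_opp K ba) (char_mulz n K (bdd_frac_diag Hpo ls)) (char_diag K ls).
rewrite mulr1 -pmulrn.
by move=> h3 h4; apply/andP; split; lra.
Qed.

(** The value at 1/(s t) is the product of the nonnegative values at 1/s and 1/t. Thus [Dloc] is
    stable under intersection. *)
Lemma OfinM s t phi : is_loc le s -> is_loc le t ->
  Ofin le (s * t) phi <-> Ofin le s phi /\ Ofin le t phi.
Proof.
move=> ls lt; have bs := bdd_frac_inv Hpo ls; have bt := bdd_frac_inv Hpo lt.
have E : KR le phi -> phi (1, s * t) = phi (1, s) * phi (1, t).
  by move=> K; have := charM K bs bt; rewrite /= mulr1.
split=> [[K]|[[K sp] [_ tp]]]; last by split=> //; rewrite E // mulr_gt0.
rewrite E // => st; have s0 := char_ge0 K bs (preord1 (po_preordering Hpo)).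
have sp : 0 < phi (1, s).
  rewrite lt_neqAle s0 andbT eq_sym; apply/eqP => z.
  by move: st; rewrite z mul0r ltxx.
by split; split=> //; rewrite -(pmulr_rgt0 _ sp).
Qed.

(** Both phi(1/t) phi(r/s) and phi(1/s) phi(r/t) equal phi(r/(s t)). *)
Lemma rfun_eq r s t phi : bdd_frac le (r, s) -> bdd_frac le (r, t) ->
  Ofin le s phi -> Ofin le t phi -> rfun r s phi = rfun r t phi.
Proof.
move=> bs bt [K sp] [_ tp]; rewrite /rfun.
have ls : is_loc le s by case: bs.
have lt : is_loc le t by case: bt.
have h1 := charM K (bdd_frac_inv Hpo lt) bs.
have h2 := charM K (bdd_frac_inv Hpo ls) bt.
rewrite /= mul1r [t * s]mulrC in h1; rewrite /= mul1r h1 in h2.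
have s0 : phi (1, s) != 0 by rewrite gt_eqF.
have t0 : phi (1, t) != 0 by rewrite gt_eqF.
apply: (mulfI s0); apply: (mulfI t0).
by rewrite mulVKf // mulrCA mulVKf.
Qed.

Lemma rfunD r s r' s' phi : bdd_frac le (r, s) -> bdd_frac le (r', s') ->
  Ofin le s phi -> Ofin le s' phi ->
  rfun (r + r') (s * s') phi = rfun r s phi + rfun r' s' phi.
Proof.
move=> b b' hs hs'; have ls : is_loc le s by case: b.
have ls' : is_loc le s' by case: b'.
have hss : Ofin le (s * s') phi by apply/OfinM.
have B : bdd_frac le (r, s * s').
  by have := bdd_fracM Hpo b (bdd_frac_inv Hpo ls'); rewrite /= mulr1.
have B' : bdd_frac le (r', s * s').
  by have := bdd_fracM Hpo (bdd_frac_inv Hpo ls) b'; rewrite /= mul1r.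
rewrite (rfun_eq b B hs hss) (rfun_eq b' B' hs' hss) /rfun char_addl ?mulrDr //.
by case: hs.
Qed.

Lemma rfunM r s r' s' phi : bdd_frac le (r, s) -> bdd_frac le (r', s') ->
  Ofin le s phi -> Ofin le s' phi ->
  rfun (r * r') (s * s') phi = rfun r s phi * rfun r' s' phi.
Proof.
move=> b b' [K _] _; have ls : is_loc le s by case: b.
have ls' : is_loc le s' by case: b'.
rewrite /rfun (charM K b b') /=.
have := charM K (bdd_frac_inv Hpo ls) (bdd_frac_inv Hpo ls'); rewrite /= mulr1 => ->.
by rewrite invfM mulrACA.
Qed.

(** Each clause of [is_char] is an equality or an inequality between continuous functions of [phi],
    hence survives limits. *)
Lemma KR_closed : closed (KR le).
Proof.
move=> phi clp.
have ev a : (fun psi : charspace A => psi a) @ within (KR le) (nbhs phi) --> phi a.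
  by move=> U /(eval_continuous (a := a)) h;
    exact: (@cvg_within _ (nbhs phi) _ (KR le) (_ @^-1` U) h).
have PK : ProperFilter (within (KR le) (nbhs phi)) by exact: within_nbhs_proper.
have lim_le (f g : charspace A -> RR) : f @ within (KR le) (nbhs phi) --> f phi ->
    g @ within (KR le) (nbhs phi) --> g phi ->
    (forall psi, KR le psi -> f psi <= g psi) -> f phi <= g phi :> RR.
  exact: le_closure clp.
have lim_eq (f g : charspace A -> RR) : f @ within (KR le) (nbhs phi) --> f phi ->
    g @ within (KR le) (nbhs phi) --> g phi ->
    (forall psi, KR le psi -> f psi = g psi) -> f phi = g phi :> RR.
  by move=> cf cg e; apply/eqP; rewrite eq_le; apply/andP; split;
    apply: lim_le => // psi K; rewrite e.
have cst (c : RR) : (fun=> c) @ within (KR le) (nbhs phi) --> c by exact: cvg_cst.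
split.
  by move=> a na; apply: (lim_eq (fun psi => psi a) (fun=> 0)) => // psi [/(_ _ na)].
split.
  move=> a b ba bb e; apply: (lim_eq (fun psi => psi a) (fun psi => psi b)) => //.
  by move=> psi K; exact: char_frac_eq.
split.
  by apply: (lim_eq (fun psi => psi (1, 1)) (fun=> 1)) => // psi [_] [_] [].
split.
  move=> a b ba bb; apply: (lim_eq (fun psi => psi (_, _))
      (fun psi => psi a + psi b)) => //; last by move=> psi K; exact: charD.
  exact: (@cvgD RR RR^o _ _ _ _ _ _ _ (ev a) (ev b)).
split.
  move=> a b ba bb; apply: (lim_eq (fun psi => psi (_, _))
      (fun psi => psi a * psi b)) => //; last by move=> psi K; exact: charM.
  exact: (@cvgM RR _ _ _ _ _ _ _ (ev a) (ev b)).
case=> r s ba r0; apply: (lim_le (fun=> 0) (fun psi => psi (r, s))) => //.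
by move=> psi K; exact: char_ge0.
Qed.

Lemma KR_compact : compact (KR le).
Proof.
have [n hn] := choice char_bound.
pose B := [set phi : charspace A | forall a, `[- (n a)%:R, (n a)%:R]%classic (phi a)].
apply: (@subclosed_compact _ _ B); first exact: KR_closed.
  apply: (@tychonoff (A * A)%type (fun=> RR)
    (fun a => `[- (n a)%:R, (n a)%:R]%classic)) => a.
  exact: segment_compact.
by move=> phi K a /=; rewrite in_itv /=; exact: hn.
Qed.

Lemma set_type_charspace_hausdorff (K : set (charspace A)) :
  hausdorff_space (set_type K).
Proof.
move=> p q clpq; apply: val_inj; apply/funext => a.
apply: (@Rhausdorff RR) => U V hU hV.
have [x [Ux Vx]] := clpq _ _ (eval_continuous_set_type hU) (eval_continuous_set_type hV).
by exists (set_val x a).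
Qed.

(* Nonnegative [c] encoding the [eps]-ball around [phi0] on the finite list [l]:
   a sum of squares [(N a - n)^2] with [n] the integer part of [N phi0(a)]. *)
Lemma neighborhood_element phi0 (l : seq (A * A)) (K : nat) (eps : RR) :
  KR le phi0 -> 0 < eps ->
  exists c, [/\ bdd_frac le c, phi0 c <= (size l)%:R &
    forall phi, KR le phi -> 0 <= phi c /\
      (phi c < K%:R -> forall a, a \in l -> `|phi a - phi0 a| < eps)].
Proof.
move=> K0 e0; elim: l => [|a l [c [bc c0 hc]]].
  exists (0, 1); split; rewrite ?char0 //; last 2 first.
  - exact: is_loc1.
  - by move=> phi K1; rewrite char0 //; exact: is_loc1.
  by apply: bdd_frac0 => //; exact: is_loc1.
have [ba|nba] := pselect (bdd_frac le a); last first.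
  exists c; split=> //; first by apply: (le_trans c0); rewrite ler_nat.
  move=> phi K1; have [h1 h2] := hc phi K1; split=> // /h2 h b.
  rewrite inE => /orP[/eqP->|]; last exact: h.
  by rewrite (proj1 K1 _ nba) (proj1 K0 _ nba) subrr normr0.
case: a ba => r s ba; have ls : is_loc le s by case: ba.
(* If the new square is below K, then |N phi(a) - n| < K + 1; as |N phi0(a) - n| <= 1, the values
   differ by less than (K + 2)/N < eps. At phi0 the square adds at most 1. *)
pose N := (Num.trunc ((K%:R + 2) / eps)).+1.
have N0 : 0 < N%:R :> RR by rewrite ltr0n.
have hN : K%:R + 2 < N%:R * eps.
  by rewrite -ltr_pdivrMr //; exact: truncnS_gt.
pose n := Num.floor (N%:R * phi0 (r, s)).
have n1 := @ge_floor _ (N%:R * phi0 (r, s)).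
have n2 := floorD1_gt (N%:R * phi0 (r, s)).
rewrite -/n intrD in n1 n2.
pose u := r *~ N%:Z + s *~ (- n).
have bu1 := bdd_frac_mulz Hpo N ba.
have bu2 := bdd_frac_mulz Hpo (- n) (bdd_frac_diag Hpo ls).
have bu : bdd_frac le (u, s) by exact: bdd_frac_addl.
have phiu phi : KR le phi -> phi (u, s) = N%:R * phi (r, s) - n%:~R.
  move=> K1; rewrite char_addl // !char_mulz //; last exact: bdd_frac_diag.
  by rewrite char_diag // mulr1 mulrNz.
have buu := bdd_fracM Hpo bu bu.
have phic phi : KR le phi ->
    phi (c.1 * (s * s) + (u * u) * c.2, c.2 * (s * s)) =
    phi c + (N%:R * phi (r, s) - n%:~R) ^+ 2.
  by move=> K1; rewrite (charD K1 bc buu) (charM K1 bu bu) phiu.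
exists (c.1 * (s * s) + (u * u) * c.2, c.2 * (s * s)); split.
- exact: bdd_fracD bc buu.
- rewrite phic // [size _]/= -natr1; apply: lerD => //.
  rewrite expr_le1 //; lra.
move=> phi K1; rewrite phic //; have [h1 h2] := hc phi K1.
have sq := sqr_ge0 (N%:R * phi (r, s) - n%:~R).
split; first exact: addr_ge0.
move=> hK b; rewrite inE => /orP[/eqP->|bl]; last by apply: h2 => //; lra.
rewrite -(ltr_pM2l N0) -[X in X * `|_| < _](gtr0_norm N0) -normrM mulrBr.
have {}hK : (N%:R * phi (r, s) - n%:~R) ^+ 2 < K%:R by lra.
have hK1 : `|N%:R * phi (r, s) - n%:~R| < K%:R + 1.
  have K0' : 0 <= K%:R :> RR by [].
  rewrite -ltr_sqr ?nnegrE ?addr_ge0 // real_normK ?num_real //.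
  apply: (lt_le_trans hK); nra.
apply: lt_trans hN; move: hK1; rewrite !ltr_norml => /andP[h3 h4].
apply/andP; split; lra.
Qed.

(** The filter generated by the traces on O_(s<oo) of the basic neighbourhoods of phi0 converges to
    phi0; the point is that it is proper, that is, no such trace is empty. *)
Lemma Ofin_dense s : archimedean_po le -> localizable le -> is_loc le s ->
  KR le `<=` closure (Ofin le s).
Proof.
move=> arch loc ls phi0 K0.
pose F : set_system (charspace A) := [set S | exists (l : seq (A * A)) (eps : RR),
  0 < eps /\ forall phi, Ofin le s phi ->
    (forall a, a \in l -> `|phi a - phi0 a| < eps) -> S phi].
have PF : ProperFilter F.
  split.
    move=> [l [eps [e0 h]]].
    (* With the threshold K = size l + 1, the element c/d - K is negative at phi0, hence not
       nonnegative. A character in O_(s<oo) where it is negative lies in the given neighbourhood. *)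
    have [[c d] [bc c0 hc]] := neighborhood_element l (size l).+1 K0 e0.
    have ld : is_loc le d by case: bc.
    have bd := bdd_frac_mulz Hpo (- (size l).+1%:Z) (bdd_frac_diag Hpo ld).
    have E phi : KR le phi -> phi (c + d *~ (- (size l).+1%:Z), d) =
        phi (c, d) - (size l).+1%:R.
      move=> K1; rewrite char_addl // char_mulz ?char_diag ?mulr1 ?mulrNz //.
      exact: bdd_frac_diag.
    have B := bdd_frac_addl Hpo bc bd.
    have [|phi hphi] := separating_char Hpo arch loc B ls.
      move=> /(char_ge0 K0 B); rewrite E // -natr1 => h0; lra.
    rewrite E ?subr_lt0; last by case: hphi.
    by move=> /(proj2 (hc _ (proj1 hphi))); exact: h.
  split.
  - by exists [::], 1; split.
  - move=> S T [l [e [e0 h]]] [l' [e' [e0' h']]].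
    exists (l ++ l'), (Num.min e e'); split; first by rewrite lt_min e0.
    move=> phi O hh; split; [apply: h|apply: h'] => // a al.
      by have := hh a; rewrite mem_cat al /= lt_min => /(_ isT)/andP[].
    by have := hh a; rewrite mem_cat al orbT lt_min => /(_ isT)/andP[].
  - move=> S T ST [l [e [e0 h]]]; exists l, e; split=> // phi O hh.
    by apply: ST; exact: h.
rewrite closureEcvg; exists F => //; split.
  apply/cvg_sup => a U [B [[W oW <-] Wp] WU].
  have /nbhs_ballP[e /= e0 eW] : nbhs (phi0 a) W by exact: open_nbhs_nbhs.
  exists [:: a], e; split=> // phi O /(_ a); rewrite mem_head => /(_ isT) h.
  by apply: WU; apply: eW; rewrite /ball /= distrC.
by move=> S OS; exists [::], 1; split=> // phi /OS.
Qed.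

End Characters.

(** * Embeddings into almost everywhere defined functions *)

Lemma dense_opensI (X : topologicalType) (U W : set X) :
  dense_opens U -> dense_opens W -> dense_opens (U `&` W).
Proof.
move=> [_ [U' [oU' eU]] dU] [_ [W' [oW' eW]] dW]; move: eU eW; rewrite !setIT => eU eW.
subst U' W'; split=> //.
  by exists (U `&` W); rewrite setIT; split=> //; exact: openI.
move=> x _ B; rewrite nbhsE => -[G [oG Gx] GB].
have [y [Uy Gy]] := dU x I G (open_nbhs_nbhs (conj oG Gx)).
have [|z [Wz [Uz Gz]]] := dW y I (U `&` G).
  by apply: open_nbhs_nbhs; split=> //; exact: openI.
by exists z; split=> //; exact: GB.
Qed.

Definition dense_ae (X : topologicalType) (P : X -> Prop) : Prop :=
  exists2 U, dense_opens U & forall x, U x -> P x.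

Lemma dense_ae2 (X : topologicalType) (P Q R : X -> Prop) :
  (forall x, P x -> Q x -> R x) -> dense_ae P -> dense_ae Q -> dense_ae R.
Proof.
move=> PQR [U dU UP] [W dW WQ]; exists (U `&` W); first exact: dense_opensI.
by move=> x [/UP ? /WQ ?]; exact: PQR.
Qed.

(** The domains of [f] and [g] are dense open themselves, so any witness can be intersected with
    them. *)
Lemma rle_dense_ae (X : topologicalType) (f g : rep X) :
  valid_rep (@dense_opens X) f -> valid_rep (@dense_opens X) g ->
  rle (@dense_opens X) f g <-> dense_ae (fun x => f.2 x <= g.2 x).
Proof.
move=> [df _] [dg _]; split=> [[U [dU _ h]]|[U dU h]]; first by exists U.
exists (U `&` (f.1 `&` g.1)); split; first by do 2 apply: dense_opensI => //.
  by move=> x [].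
by move=> x [/h].
Qed.

Lemma dense_opensT (X : topologicalType) : dense_opens [set: X].
Proof.
split=> //; first by exists setT; split; [exact: openT|rewrite setIT].
exact: subset_closure.
Qed.

Lemma valid_rep_rcst (X : topologicalType) (c : RR) :
  valid_rep (@dense_opens X) (rcst [set: X] c).
Proof.
split; first exact: dense_opensT.
by apply/subspace_continuousP => x _; exact: cvg_cst.
Qed.

(** Continuity turns a comparison on some dense set into one on the whole common domain. *)
Lemma valid_rep_le_closure (T : topologicalType) (W : set T) (f g : rep T) x :
  {within f.1, continuous f.2} -> {within g.1, continuous g.2} ->
  W `<=` f.1 `&` g.1 -> (forall y, W y -> f.2 y <= g.2 y) ->
  closure W x -> f.1 x -> g.1 x -> f.2 x <= g.2 x.
Proof.
move=> /subspace_continuousP cf /subspace_continuousP cg Wfg fg clW fx gx.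
by apply: (le_closure clW) => //; [apply: cvg_trans (cf _ fx)
  |apply: cvg_trans (cg _ gx)]; apply: cvg_app; apply: within_subset => y /Wfg[].
Qed.

Section Embedding.
Context (A : comPzRingType) (le : A -> A -> Prop) (Hpo : is_po_ring le).
Context (X : topologicalType) (Phi : A -> rep X).
Hypothesis emb : po_ring_embedding le [set: X] (@dense_opens X) Phi.
Let f r := (Phi r).2.

Lemma emb_nonneg r : le 0 r <-> dense_ae (fun x => 0 <= f r x).
Proof.
case: emb => v [_] [_] [_] [_ h]; rewrite h; apply: rle_dense_ae => //.
exact: valid_rep_rcst.
Qed.

Lemma emb1 : dense_ae (fun x => f 1 x = 1).
Proof. by case: emb => _ [[U [dU _ h]] _]; exists U. Qed.

Lemma embD r s : dense_ae (fun x => f (r + s) x = f r x + f s x).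
Proof. by case: emb => _ [_] [/(_ r s) [U [dU _ h]] _]; exists U. Qed.

Lemma embM r s : dense_ae (fun x => f (r * s) x = f r x * f s x).
Proof. by case: emb => _ [_] [_] [/(_ r s) [U [dU _ h]] _]; exists U. Qed.

Lemma embMn r n : dense_ae (fun x => f (r *+ n) x = n%:R * f r x).
Proof.
elim: n => [|n IH].
  have [U dU h] := embD 0 0; exists U => // x /h.
  by rewrite addr0 mulr0n => e; lra.
apply: (dense_ae2 _ IH (embD r (r *+ n))) => x e.
by rewrite -mulrS e => ->; rewrite mulrS; lra.
Qed.

(** The dense open set on which k g + h >= 0 depends on k, and a countable intersection of such sets
    need not be open. Each inequality is therefore first extended by continuity to the fixed set dom
    g [&] dom h, where the archimedean property of the reals applies pointwise. *)
Lemma emb_archimedean : archimedean_po le.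
Proof.
move=> g h H; apply/emb_nonneg.
case: (emb) => v _; have [dg cg] := v g; have [dh ch] := v h.
exists ((Phi g).1 `&` (Phi h).1); first exact: dense_opensI.
move=> x [gx hx].
have key (k : nat) : (0 < k)%N -> 0 <= k%:R * f g x + f h x.
  move=> k0.
  have [U dU hU] : dense_ae (fun x => 0 <= k%:R * f g x + f h x).
    have := dense_ae2 _ (embD (g *+ k) h) (embMn g k).
    move=> /(_ (fun x => f (g *+ k + h) x = k%:R * f g x + f h x)) e.
    apply: (dense_ae2 _ ((emb_nonneg _).1 (H k k0)) (e _)).
      by move=> y h0 <-.
    by move=> y -> ->.
  have [_ _ dW] := dense_opensI dU (dense_opensI dg dh).
  have clW := dW x I.
  apply: (le_closure (f := fun=> 0) (g := fun y => k%:R * f g y + f h y) clW).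
  - exact: cvg_cst.
  - move/subspace_continuousP: cg => /(_ x gx) cg.
    move/subspace_continuousP: ch => /(_ x hx) ch.
    have sub (D : set X) : (Phi g).1 `&` (Phi h).1 `<=` D ->
        within (U `&` ((Phi g).1 `&` (Phi h).1)) (nbhs x) `=>` within D (nbhs x).
      by move=> sD; apply: within_subset => y [_ /sD].
    apply: (@cvgD RR RR^o).
      apply: (@cvgM RR); first exact: cvg_cst.
      by apply: cvg_trans cg; apply: cvg_app; apply: sub => y [].
    by apply: cvg_trans ch; apply: cvg_app; apply: sub => y [].
  - by move=> y [/hU].
rewrite leNgt; apply/negP => neg.
have := key (Num.trunc (f h x / - f g x)).+1 isT.
apply/negP; rewrite -ltNge -ltrBDr sub0r -ltrN2 opprK -mulrN -ltr_pdivrMr ?oppr_gt0 //.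
exact: truncnS_gt.
Qed.

(** Where the representative of s is at least 1, it can be cancelled pointwise. *)
Lemma emb_strongly_localizable : strongly_localizable le.
Proof.
case: (Hpo) => _ [_] [_] [_] [_ sq].
split=> [r|s s1]; first by rewrite expr2.
split=> // r rs; apply/emb_nonneg.
have h1 : dense_ae (fun x => 1 <= f s x).
  have := dense_ae2 _ (embD (s - 1) 1) emb1.
  move=> /(_ (fun x => f s x = f (s - 1) x + 1)) e.
  apply: (dense_ae2 _ ((emb_nonneg _).1 s1) (e _)) => [x h0 ->|x]; first by lra.
  by rewrite subrK => -> ->.
have h2 : dense_ae (fun x => 0 <= f r x * f s x).
  by apply: (dense_ae2 _ ((emb_nonneg _).1 rs) (embM r s)) => x + <-.
apply: (dense_ae2 _ h1 h2) => x e1; rewrite pmulr_lge0 //; lra.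
Qed.

End Embedding.

(** * The extended Gelfand transformation *)

Section Gelfand.
Context (A : comPzRingType) (le : A -> A -> Prop) (Hpo : is_po_ring le).

Lemma strongly_localizable_localizable :
  strongly_localizable le -> localizable le.
Proof.
have P := po_preordering Hpo.
move=> [sq loc] r; have l2 : is_loc le (1 + 1).
  by apply: loc; rewrite addrK; exact: preord1 P.
(* 2 is in [Loc] and [2 (1 + r^2 +- r)] is a sum of squares *)
have two x : le 0 (x *+ 2) -> le 0 x.
  by move=> h; apply: (proj2 l2); have -> : x * (1 + 1) = x *+ 2 by ring.
have pos1 : le 0 1 by exact: preord1 P.
exists (1 + r ^+ 2); split; first by apply: loc; rewrite addrAC subrr add0r.
  apply/(po_subr Hpo); apply: two.
  have -> : (r - - (1 + r ^+ 2)) *+ 2 = 1 + r ^+ 2 + (1 + r) ^+ 2 by ring.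
  by apply: (preordD P) => //; apply: (preordD P).
apply/(po_subr Hpo); apply: two.
have -> : (1 + r ^+ 2 - r) *+ 2 = 1 + r ^+ 2 + (1 - r) ^+ 2 by ring.
by apply: (preordD P) => //; apply: (preordD P).
Qed.

Lemma loc_boundP r : localizable le -> bdd_frac le (r, loc_bound le r).
Proof.
move=> /(localizable_bdd_frac Hpo r) [s bs]; rewrite /loc_bound.
by case: xgetP => [y _ //|/(_ s)].
Qed.

Lemma loc_bound_loc r : localizable le -> is_loc le (loc_bound le r).
Proof. by move=> /(loc_boundP r) []. Qed.

Lemma rfun_ge0 r s phi : bdd_frac le (r, s) -> Ofin le s phi ->
  (0 <= rfun r s phi) = (0 <= phi (r, s)).
Proof. by move=> b [K sp]; rewrite /rfun pmulr_rge0 // invr_gt0. Qed.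

(** Nonnegativity of the transform may be known only on some smaller O_(t<oo), so the separating
    character is taken inside this set. *)
Lemma gelfand_embedding_of_archimedean : archimedean_po le -> localizable le ->
  gelfand_order_embedding le.
Proof.
move=> arch loc r; have b := loc_boundP r loc; have ls := loc_bound_loc r loc.
split=> [r0|[_ [[t [lt ->]] sub h]]].
  exists (Ofin le (loc_bound le r)); split.
  - by exists (loc_bound le r).
  - by move=> phi O; split=> //; case: O.
  - by move=> phi O /=; rewrite (rfun_ge0 b O); exact: (char_ge0 (proj1 O) b r0).
apply: contrapT => nr.
have [phi Ot] := separating_char Hpo arch loc b lt nr.
have [_ Os] := sub _ Ot; have := h _ Ot; rewrite /= rfun_ge0 // => h1.
by rewrite ltNge h1.
Qed.

(** For s and t bounding g and h, the set O_(s t<oo) serves all k at once, and the archimedean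
    property of the reals is used at each of its characters. *)
Lemma archimedean_of_gelfand_embedding : localizable le ->
  gelfand_order_embedding le -> archimedean_po le.
Proof.
move=> loc gel g h H; apply/gel.
have bg := loc_boundP g loc; have ls := loc_bound_loc g loc.
set s := loc_bound le g in bg ls *.
have bh := loc_boundP h loc; have lt := loc_bound_loc h loc.
set t := loc_bound le h in bh lt.
have lst := is_locM Hpo ls lt.
exists (Ofin le (s * t)); split; first by exists (s * t).
  by move=> phi /OfinM[]// Os Ot; split=> //; case: Os.
move=> phi /OfinM[]// Os Ot /=; rewrite rfun_ge0 //; have K := proj1 Os.
(* [(k g + h) / (s t)] is nonnegative for every [k], hence so is its image *)
have Bg : bdd_frac le (g, s * t).
  by have := bdd_fracM Hpo bg (bdd_frac_inv Hpo lt); rewrite /= mulr1.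
have Bh : bdd_frac le (h, s * t).
  by have := bdd_fracM Hpo (bdd_frac_inv Hpo ls) bh; rewrite /= mul1r.
have e : phi (g, s * t) = phi (g, s) * phi (1, t).
  by have := charM K bg (bdd_frac_inv Hpo lt); rewrite /= mulr1.
have tp : 0 < phi (1, t) by case: Ot.
rewrite -(pmulr_lge0 _ tp) -e leNgt; apply/negP => neg.
pose k := (Num.trunc (phi (h, s * t) / - phi (g, s * t))).+1.
have Bk := bdd_frac_mulz Hpo k Bg.
have := char_ge0 K (bdd_frac_addl Hpo Bk Bh) (H k isT).
rewrite (char_addl Hpo K Bk Bh) (char_mulz Hpo k K Bg) -pmulrn.
apply/negP; rewrite -ltNge -ltrBDr sub0r -ltrN2 opprK -mulrN -ltr_pdivrMr ?oppr_gt0 //.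
exact: truncnS_gt.
Qed.

Lemma Ofin_open_dense s : archimedean_po le -> localizable le -> is_loc le s ->
  dense_open_in (KR le) (Ofin le s).
Proof.
move=> arch loc ls; split; [by move=> phi []| |exact: Ofin_dense].
exists [set phi : charspace A | 0 < phi (1, s)]; split; last first.
  by apply/seteqP; split=> phi [].
apply: (@open_comp _ _ (fun phi : charspace A => phi (1, s)) [set x | 0 < x]).
  by move=> phi _; exact: eval_continuous.
exact: open_gt.
Qed.

(** The common domain O_(s t<oo) is itself a member of [Dloc], and the inequality reaches all of it
    by continuity. *)
Lemma rle_dense_Dloc (f g : rep (charspace A)) : archimedean_po le ->
  localizable le -> valid_rep (Dloc le) f -> valid_rep (Dloc le) g ->
  rle (dense_open_in (KR le)) f g -> rle (Dloc le) f g.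
Proof.
move=> arch loc [[s [ls ef]] cf] [[t [lt eg]] cg] [U [[UK _ dU] sub h]].
exists (Ofin le (s * t)); split.
- by exists (s * t); split=> //; exact: is_locM.
- by rewrite ef eg => phi /OfinM[].
move=> phi /OfinM[]// Os Ot; apply: (valid_rep_le_closure cf cg sub h).
- by apply: dU; case: Os.
- by rewrite ef.
- by rewrite eg.
Qed.

(** The Gelfand transform transported to K(R) as a space in its own right, the form required by
    statement (i). *)
Definition gelfand_set_type (r : A) : rep (set_type (KR le)) :=
  (set_val @^-1` Ofin le (loc_bound le r),
   fun x => rfun r (loc_bound le r) (set_val x)).

Lemma gelfand_set_type_embedding : archimedean_po le -> localizable le ->
  po_ring_embedding le [set: set_type (KR le)]
    (@dense_opens (set_type (KR le))) gelfand_set_type.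
Proof.
move=> arch loc; set X := set_type (KR le).
have b r := loc_boundP r loc; have lb r := loc_bound_loc r loc.
have domain s : is_loc le s -> dense_opens (set_val @^-1` Ofin le s : set X).
  move=> ls; have [OK [G [oG eG]] dO] := Ofin_open_dense arch loc ls.
  split=> //.
    exists (set_val @^-1` G); split; first by exists G.
    rewrite setIT eG; apply/seteqP; split=> [x []|x Gx] //.
    by split=> //; exact: set_valP.
  by move=> x _; apply: closure_set_type => //; apply: dO; exact: set_valP.
have valid r : valid_rep (@dense_opens X) (gelfand_set_type r).
  split; first exact: domain.
  apply/subspace_continuousP => x [_ xs]; apply: (@cvgM RR).
    apply: (@cvgV RR); first by rewrite gt_eqF.
    by move=> U /(eval_continuous_set_type (a := _)) h;
      exact: (@cvg_within _ (nbhs x) _ _ (_ @^-1` U) h).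
  by move=> U /(eval_continuous_set_type (a := _)) h;
      exact: (@cvg_within _ (nbhs x) _ _ (_ @^-1` U) h).
have add r s : req (@dense_opens X) (gelfand_set_type (r + s))
    (radd (gelfand_set_type r) (gelfand_set_type s)).
  set u := loc_bound le r; set v := loc_bound le s; set w := loc_bound le (r + s).
  have luv : is_loc le (u * v) by apply: is_locM; [|exact: lb|exact: lb].
  (* The denominators [u], [v], [w] are chosen independently of each other; on this set all three
     are finite and [rfun_eq] allows passing from [w] to u v. *)
  exists (set_val @^-1` Ofin le (u * v * w)); split.
  - by apply: domain; apply: is_locM => //; exact: lb.
  - by move=> x /= /(OfinM Hpo _ luv (lb _))[/(OfinM Hpo _ (lb r) (lb s))[]].
  move=> x /= /(OfinM Hpo _ luv (lb _))[].
  move=> /[dup] Ouv /(OfinM Hpo _ (lb r) (lb s))[] Ou Ov Ow.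
  rewrite -(rfunD Hpo (b r) (b s) Ou Ov); apply: (rfun_eq Hpo) => //.
  apply: bdd_frac_addl => //.
    by have := bdd_fracM Hpo (b r) (bdd_frac_inv Hpo (lb s)); rewrite /= mulr1.
  by have := bdd_fracM Hpo (bdd_frac_inv Hpo (lb r)) (b s); rewrite /= mul1r.
have nonneg r : le 0 r <-> rle (@dense_opens X) (rcst setT 0) (gelfand_set_type r).
  split=> [r0|[U [[_ _ dU] sub h]]].
    exists (set_val @^-1` Ofin le (loc_bound le r)); split=> //; first exact: domain.
    by move=> x O /=; rewrite (rfun_ge0 (b r) O); exact: (char_ge0 (proj1 O) (b r) r0).
  (* A single point of the domain with a negative value suffices, since the inequality on the dense
     set [U] extends to the full domain. *)
  apply: contrapT => nr.
  have [phi Os] := separating_char Hpo arch loc (b r) (lb r) nr.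
  apply/negP; rewrite -leNgt -rfun_ge0 //.
  pose x : X := exist _ phi (mem_set (proj1 Os)).
  apply: (@valid_rep_le_closure _ U (rcst setT 0) (gelfand_set_type r) x) => //.
  - by case: (@valid_rep_rcst X 0).
  - by case: (valid r).
  - exact: dU.
split; first exact: valid.
split.
  exists (set_val @^-1` Ofin le (loc_bound le 1)); split=> //; first exact: domain.
  by move=> x [_ sp]; rewrite /= /rfun mulVf // gt_eqF.
split; first exact: add.
split.
  move=> r s; set u := loc_bound le r; set v := loc_bound le s.
  set w := loc_bound le (r * s).
  have luv : is_loc le (u * v) by apply: is_locM; [|exact: lb|exact: lb].
  exists (set_val @^-1` Ofin le (u * v * w)); split.
  - by apply: domain; apply: is_locM => //; exact: lb.
  - by move=> x /= /(OfinM Hpo _ luv (lb _))[/(OfinM Hpo _ (lb r) (lb s))[]].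
  move=> x /= /(OfinM Hpo _ luv (lb _))[].
  move=> /[dup] Ouv /(OfinM Hpo _ (lb r) (lb s))[] Ou Ov Ow.
  rewrite -(rfunM Hpo (b r) (b s) Ou Ov); apply: (rfun_eq Hpo) => //.
  exact: (bdd_fracM Hpo (b r) (b s)).
split; last exact: nonneg.
(* Injectivity comes from the order: equal images give both r - s >= 0 and s - r >= 0. *)
have ge r s : req (@dense_opens X) (gelfand_set_type r) (gelfand_set_type s) ->
    le 0 (r - s).
  move=> [U [dU _ eU]]; apply/nonneg/rle_dense_ae => //; first exact: valid_rep_rcst.
  have [W [dW _ eW]] := add (r - s) s; rewrite subrK in eW.
  apply: dense_ae2 (ex_intro2 _ _ U dU eU) (ex_intro2 _ _ W dW eW) => x /= -> e.
  lra.
move=> r s e; case: Hpo => _ [anti _]; apply: anti; apply/po_subr => //.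
  apply: ge; case: e => U [dU sub eU]; exists U; split=> //.
    by move=> x /sub[].
  by move=> x /eU.
exact: ge.
Qed.

End Gelfand.

Theorem theorem31 (A : comPzRingType) (le : A -> A -> Prop)
  (Hpo : is_po_ring le) :
  let stmt_i :=
    exists X : topologicalType,
      [/\ compact [set: X], hausdorff_space X &
          exists Phi : A -> rep X,
            po_ring_embedding le [set: X] (@dense_opens X) Phi] in
  let stmt_ii := localizable le /\ gelfand_order_embedding le in
  let stmt_iii := archimedean_po le /\ localizable le in
  let stmt_iv := archimedean_po le /\ strongly_localizable le in
  ((stmt_i <-> stmt_ii) /\ (stmt_i <-> stmt_iii) /\ (stmt_i <-> stmt_iv)) /\
  (stmt_iii ->
     (forall s : A, is_loc le s -> KR le `<=` closure (Ofin le s)) /\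
     (forall f g : rep (charspace A),
        valid_rep (Dloc le) f -> valid_rep (Dloc le) g ->
        [/\ valid_rep (dense_open_in (KR le)) f,
            (req (Dloc le) f g -> req (dense_open_in (KR le)) f g)
          & (rle (dense_open_in (KR le)) f g <-> rle (Dloc le) f g)])).
Proof.
move=> stmt_i stmt_ii stmt_iii stmt_iv.
(* The implications shown are (i) => (iv) => (iii) => (i) and (ii) <=> (iii); the space for (i) is
   K(R). *)
have i_iv : stmt_i -> stmt_iv.
  move=> [X [_ _ [Phi emb]]]; split; first exact: emb_archimedean emb.
  exact: emb_strongly_localizable emb.
have iv_iii : stmt_iv -> stmt_iii.
  by move=> [arch sl]; split=> //; exact: strongly_localizable_localizable.
have iii_ii : stmt_iii -> stmt_ii.
  by move=> [arch loc]; split=> //; exact: gelfand_embedding_of_archimedean.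
have ii_iii : stmt_ii -> stmt_iii.
  by move=> [loc gel]; split=> //; exact: archimedean_of_gelfand_embedding.
have iii_i : stmt_iii -> stmt_i.
  move=> [arch loc]; exists (set_type (KR le)); split.
  - exact/compact_set_type/KR_compact.
  - exact: set_type_charspace_hausdorff.
  - by exists (gelfand_set_type le); exact: gelfand_set_type_embedding.
split; first by split; [|split]; split; auto.
move=> [arch loc]; split; first by move=> s; exact: Ofin_dense.
(* By density every domain in [Dloc] is also one for the almost everywhere ring, so validity,
   equivalence and order carry over with the same witness. *)
have DlocW U : Dloc le U -> dense_open_in (KR le) U.
  by move=> [s [ls ->]]; exact: Ofin_open_dense.
move=> f g vf vg; split.
- by case: vf => /DlocW.
- by move=> [U [/DlocW]]; exists U.
- split; first exact: rle_dense_Dloc.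
  by move=> [U [/DlocW]]; exists U.
Qed.
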